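(* Let $n\ge 2$. For every $\sigma\in S_n$ and all complex $n\times 1$ vectors $x$, writing $X=\mathcal{T}x$, we have $$\mathcal{T}P(\sigma)\,x=\left[1\oplus D_{\phi}(\sigma)^{t}\right]X .$$
   Context: $S_n$ is the symmetric group on $\{1,\ldots,n\}$, with product given by composition, $(\sigma\delta)(i)=\sigma(\delta(i))$. $\mathcal{I}_m$ denotes the $m\times m$ identity matrix, ${}^t$ denotes transpose, and $\oplus$ denotes the block-diagonal direct sum of matrices ($1$ is the $1\times1$ matrix with entry $1$). Permutation matrices: for $\sigma\in S_n$, $P(\sigma)$ is the $n\times n$ matrix with entries $P(\sigma)_{i,j}=(\mathcal{I}_n)_{\sigma(i),j}$, so that $(P(\sigma)x)(i)=x(\sigma(i))$. The representation $D_\phi$, $\phi=(n-1,1)$: let $\tau_k=(k,k+1)$, $1\le k\le n-1$, be the adjacent transpositions. $D_\phi$ is the Young orthogonal representation for the partition $\phi=(n-1,1)$, i.e. the group homomorphism from $S_n$ to the real orthogonal $(n-1)\times(n-1)$ matrices determined by its values on the generators $\tau_k$: $D_\phi(\tau_1)=\mathrm{diag}[1,1,\ldots,1,-1]$, and for $k=2,\ldots,n-1$, $$D_\phi(\tau_k)=\mathcal{I}_{n-k-1}\oplus R_k\oplus \mathcal{I}_{k-2},\qquad R_k=\begin{pmatrix}-\frac1k&\sqrt{1-\frac1{k^2}}\\ \sqrt{1-\frac1{k^2}}&\frac1k\end{pmatrix}.$$ (These matrices satisfy the Coxeter relations, so the homomorphism exists.) The matrix $\mathcal{T}$: let $U$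 be the $n\times n$ matrix whose first row consists entirely of $1$'s, and whose $m$-th row, for $2\le m\le n$, has entries $-1$ in columns $1,\ldots,n-m+1$, entry $n-m+1$ in column $n-m+2$, and $0$ in all later columns (so row $2$ is $(-1,\ldots,-1,n-1)$ and row $n$ is $(-1,1,0,\ldots,0)$). Let $A=(UU^t)^{-1/2}$, which is the diagonal matrix with $A_{1,1}=1/\sqrt n$ and $A_{k,k}=1/\sqrt{(n-k+1)(n-k+2)}$ for $k>1$. Set $\mathcal{T}=AU$. *)

(* Defs.v *)
From HB Require Import structures.
From mathcomp Require Import all_boot all_order all_fingroup all_algebra.
From mathcomp Require Import reals.
From mathcomp.real_closed Require Export complex.
From mathcomp Require Import ring.

Set Implicit Arguments.
Unset Strict Implicit.
Unset Printing Implicit Defensive.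

Import Order.TTheory GRing.Theory Num.Theory.
Local Open Scope ring_scope.
Local Open Scope complex_scope.

(* Indices are 0-based: the letter k of {1, .., n} is the ordinal of value     *)
(* k - 1, and likewise for the rows and columns of matrices.                   *)

Section Blocks.
Variable R : pzRingType.

Definition dsum (p q : nat) (A : 'M[R]_p) (B : 'M[R]_q) : 'M[R]_(p + q) :=
  block_mx A 0 0 B.

Lemma dim_one_dsum (n : nat) : (2 <= n)%N -> (1 + n.-1)%N = n.
Proof. by case: n. Qed.

Definition one_dsum (n : nat) (hn : (2 <= n)%N) (B : 'M[R]_n.-1) : 'M[R]_n :=
  castmx (dim_one_dsum hn, dim_one_dsum hn) (dsum (1%:M : 'M[R]_1) B).

End Blocks.

Section Young.
Variable R : realType.

Lemma tau_fst (n k : nat) : (1 <= k < n)%N -> (k.-1 < n)%N.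
Proof. by case/andP=> _; apply: leq_ltn_trans; apply: leq_pred. Qed.

Lemma tau_snd (n k : nat) : (1 <= k < n)%N -> (k < n)%N.
Proof. by case/andP. Qed.

(* The transposition (k, k+1) of {1, .., n}. *)
Definition tau (n k : nat) (hk : (1 <= k < n)%N) : 'S_n :=
  tperm (Ordinal (tau_fst hk)) (Ordinal (tau_snd hk)).

Definition Rmx (k : nat) : 'M[R]_2 :=
  \matrix_(i, j)
    if i == j then (if i == 0 then - (k%:R)^-1 else (k%:R)^-1)
    else Num.sqrt (1 - (k%:R ^+ 2)^-1).

Lemma dim_Dtau (n k : nat) :
  (2 <= k < n)%N -> (n - k - 1 + (2 + (k - 2)))%N = n.-1.
Proof.
case/andP=> k2 kn; rewrite subnKC // -subnDA addn1.
by case: n kn => // n kn; rewrite subSS subnK.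
Qed.

Definition Dtau1 (n : nat) : 'M[R]_n.-1 :=
  diag_mx (\row_l if l.+1 == n.-1 then -1 else 1).

Definition Dtau (n k : nat) (hk : (2 <= k < n)%N) : 'M[R]_n.-1 :=
  castmx (dim_Dtau hk, dim_Dtau hk)
    (dsum (1%:M : 'M[R]_(n - k - 1)) (dsum (Rmx k) (1%:M : 'M[R]_(k - 2)))).

(* MathComp composes permutations from left to right, (t * s) i = s (t i), so  *)
(* the composite written "s t" (first t, then s) is (t * s)%g.                 *)
Record young_orthogonal (n : nat) (D : 'S_n -> 'M[R]_n.-1) : Prop :=
  YoungOrthogonal {
    young_orth : forall s : 'S_n, D s *m (D s)^T = 1%:M;
    young_mul : forall s t : 'S_n, D (t * s)%g = D s *m D t;
    young_tau1 : forall h1 : (1 <= 1 < n)%N, D (tau h1) = Dtau1 n;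
    young_tau : forall (k : nat) (h1 : (1 <= k < n)%N) (hk : (2 <= k < n)%N),
      D (tau h1) = Dtau hk
  }.

Definition Umx (n : nat) : 'M[R]_n :=
  \matrix_(i, j)
    if i == 0 :> nat then 1
    else if (j < n - i)%N then -1
    else if j == (n - i)%N :> nat then (n - i)%:R
    else 0.

(* The inverse positive square root of U U^t: see Amx_invsqrt below. *)
Definition Amx (n : nat) : 'M[R]_n :=
  diag_mx (\row_i
    if i == 0 :> nat then (Num.sqrt n%:R)^-1
    else (Num.sqrt ((n - i) * (n - i).+1)%:R)^-1).

Definition Tmx (n : nat) : 'M[R]_n := Amx n *m Umx n.

Lemma Umx_row_sum (n m : nat) (a b : R) : (m < n)%N ->
  \sum_(l < n) (if (l < m)%N then a else if l == m :> nat then b else 0)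
    = a *+ m + b.
Proof.
move=> mn.
rewrite -(big_mkord xpredT (fun l => if (l < m)%N then a
                                     else if l == m then b else 0)).
rewrite (big_cat_nat (n := m)) //=; last exact: ltnW.
congr (_ + _).
  rewrite (eq_big_nat _ _ (F2 := fun=> a)); last by move=> i /andP[_ ->].
  by rewrite sumr_const_nat subn0.
rewrite big_ltn // ltnn eqxx big_nat_cond big1 ?addr0 // => i.
by rewrite andbT => /andP[mi _]; rewrite ltnNge ltnW //= gtn_eqF.
Qed.

Lemma Umx_gram (n : nat) : Umx n *m (Umx n)^T =
  diag_mx (\row_i if i == 0 :> nat then n%:R else ((n - i) * (n - i).+1)%:R).
Proof.
set d := \row_i _.
have sym (i j : 'I_n) :
    (Umx n *m (Umx n)^T) i j = (Umx n *m (Umx n)^T) j i.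
  by rewrite !mxE; apply: eq_bigr => l _; rewrite !mxE mulrC.
have dsym (i j : 'I_n) : diag_mx d i j = diag_mx d j i.
  by rewrite mxE [RHS]mxE (eq_sym j); case: (eqVneq i j) => // ->.
apply/matrixP => i j.
wlog ij : i j / (i <= j)%N.
  by move=> W; case/orP: (leq_total i j) => h;
    [exact: W | rewrite sym dsym; exact: W].
rewrite !mxE; case: (posnP j) => [j0|j0].
  have i0 : i = 0%N :> nat by apply/eqP; rewrite -leqn0 -j0.
  have -> : i = j by apply: val_inj; rewrite /= i0 j0.
  rewrite eqxx j0 eqxx mulr1n (eq_bigr (fun=> 1)); last first.
    by move=> l _; rewrite !mxE j0 eqxx mulr1.
  by rewrite sumr_const card_ord.
have mn : (n - j < n)%N.
  by rewrite ltn_subrL j0 (leq_ltn_trans _ (ltn_ord j)).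
have [eij|nij] := eqVneq i j.
  rewrite eij gtn_eqF // mulr1n.
  rewrite (eq_bigr (fun l : 'I_n => if (l < n - j)%N then 1 else
     if l == (n - j)%N :> nat then (n - j)%:R * (n - j)%:R else 0)).
    by rewrite Umx_row_sum // mulnS natrD natrM.
  move=> l _; rewrite !mxE gtn_eqF //.
  by case: ifP => _; [rewrite mulrNN mulr1 | case: ifP => _; rewrite ?mulr0].
rewrite mulr0n.
have ltij : (i < j)%N by rewrite ltn_neqAle ij andbT.
have E (a : R) : (forall l : 'I_n, (l <= n - j)%N -> Umx n i l = a) ->
    \sum_l Umx n i l * (Umx n)^T l j = 0.
  move=> Ha; rewrite (eq_bigr (fun l : 'I_n => if (l < n - j)%N then - a else
     if l == (n - j)%N :> nat then a * (n - j)%:R else 0)).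
    by rewrite Umx_row_sum // mulNrn mulr_natr addNr.
  move=> l _; rewrite [X in _ * X]mxE [X in _ * X]mxE gtn_eqF //.
  case: ifP => h; first by rewrite (Ha l (ltnW h)) mulrN1.
  by case: ifP => [/eqP h2|_]; rewrite ?mulr0 // Ha // h2.
case: (posnP i) => i0; first by apply: (E 1) => l _; rewrite mxE i0 eqxx.
apply: (E (-1)) => l hl; rewrite mxE gtn_eqF // ifT //.
by apply: leq_ltn_trans hl _; apply: ltn_sub2l => //; apply: ltn_ord.
Qed.

Lemma Amx_invsqrt (n : nat) :
  [/\ (Amx n)^T = Amx n,
      forall v : 'cV[R]_n, v != 0 -> 0 < (v^T *m Amx n *m v) 0 0
    & (Amx n *m Amx n) *m (Umx n *m (Umx n)^T) = 1%:M].
Proof.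
pose d (i : 'I_n) : R :=
  if i == 0 :> nat then n%:R else ((n - i) * (n - i).+1)%:R.
have d0 i : 0 < d i.
  rewrite /d; case: ifP => _; rewrite ltr0n.
    exact: leq_ltn_trans (ltn_ord i).
  by rewrite muln_gt0 subn_gt0 ltn_ord.
have AE : Amx n = diag_mx (\row_i (Num.sqrt (d i))^-1).
  by congr diag_mx; apply/rowP => i; rewrite !mxE /d; case: ifP.
split.
- by rewrite AE tr_diag_mx.
- move=> v v0; rewrite AE mul_mx_diag mxE.
  have [i vi] : exists i, v i 0 != 0.
    apply/existsP; apply: contraR v0; rewrite negb_exists => /forallP v0.
    by apply/eqP/colP => i; rewrite mxE; apply/eqP; move: (v0 i); rewrite negbK.
  have sE j : (\matrix_(i, j) (v^T i j * (\row_k (Num.sqrt (d k))^-1) 0 j)) 0 j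
      * v j 0 = (Num.sqrt (d j))^-1 * v j 0 ^+ 2 by rewrite !mxE; ring.
  rewrite (eq_bigr _ (fun j _ => sE j)) (bigD1 i) //=.
  rewrite ltr_pwDl //.
    by rewrite mulr_gt0 ?invr_gt0 ?sqrtr_gt0 // exprn_even_gt0.
  by apply: sumr_ge0 => j _; rewrite mulr_ge0 ?sqr_ge0 // invr_ge0 sqrtr_ge0.
- rewrite AE Umx_gram !mulmx_diag -diag_const_mx; congr diag_mx.
  apply/rowP => i; rewrite !mxE -/(d i) -invfM -expr2 sqr_sqrtr ?(ltW (d0 i)) //.
  by rewrite mulVf // gt_eqF.
Qed.

Definition toC (p q : nat) (M : 'M[R]_(p, q)) : 'M[R[i]]_(p, q) :=
  map_mx (real_complex R) M.

End Young.

(* Main.v *)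
(* Both s |-> perm_mx s and s |-> 1 (+) (D s)^T reverse composition in the same
   way, so it is enough to compare the two sides on the adjacent transpositions
   tau_k, which generate S_n. Right multiplication by perm_mx tau_k swaps the
   columns k and k + 1 of T; these differ only in the two rows which
   1 (+) D(tau_k) mixes, and there the entries agree because
   sqrt (1 - 1/k^2) = sqrt (k - 1) sqrt (k + 1) / k. *)

Require Import Defs.
From HB Require Import structures.
From mathcomp Require Import all_boot all_order all_fingroup all_algebra.
From mathcomp Require Import reals.
From mathcomp.real_closed Require Import complex.
From mathcomp Require Import zify ring.

Set Implicit Arguments.
Unset Strict Implicit.
Unset Printing Implicit Defensive.

Import Order.TTheory GRing.Theory Num.Theory.

Local Open Scope ring_scope.
Local Open Scope complex_scope.

(** * Block-diagonal sums: products, casts, entries *)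

Lemma dsum_mul (R : pzRingType) (p q : nat) (A A' : 'M[R]_p) (B B' : 'M[R]_q) :
  dsum A B *m dsum A' B' = dsum (A *m A') (B *m B').
Proof. by rewrite /dsum mulmx_block !mulmx0 !mul0mx !addr0 !add0r. Qed.

Lemma dsum1 (R : pzRingType) (p q : nat) :
  dsum (1%:M : 'M[R]_p) (1%:M : 'M[R]_q) = 1%:M.
Proof. by rewrite /dsum -scalar_mx_block. Qed.

(** With both sizes variable, [e] can be eliminated and the cast disappears. *)
Lemma castmx_sq_mul (R : pzRingType) (p q : nat) (e : p = q) (A B : 'M[R]_p) :
  castmx (e, e) A *m castmx (e, e) B = castmx (e, e) (A *m B).
Proof. by case: q / e. Qed.

Lemma castmx_sq1 (R : pzRingType) (p q : nat) (e : p = q) :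
  castmx (e, e) (1%:M : 'M[R]_p) = 1%:M.
Proof. by case: q / e. Qed.

Lemma one_dsum_mul (R : pzRingType) (n : nat) (hn : (2 <= n)%N)
    (A B : 'M[R]_n.-1) :
  one_dsum hn A *m one_dsum hn B = one_dsum hn (A *m B).
Proof. by rewrite /one_dsum castmx_sq_mul dsum_mul mulmx1. Qed.

Lemma one_dsum1 (R : pzRingType) (n : nat) (hn : (2 <= n)%N) :
  one_dsum hn (1%:M : 'M[R]_n.-1) = 1%:M.
Proof. by rewrite /one_dsum dsum1 castmx_sq1. Qed.

(** Reading the entries of [B] through a function on [nat] allows the shift to [i.-1] and [j.-1]
    without bound proofs. *)
Lemma one_dsumE (R : pzRingType) (n : nat) (hn : (2 <= n)%N)
    (B : 'M[R]_n.-1) (f : nat -> nat -> R) :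
  (forall u v : 'I_n.-1, B u v = f u v) ->
  forall i j : 'I_n, one_dsum hn B i j =
    if (i == 0 :> nat) || (j == 0 :> nat) then (i == j :> nat)%:R
    else f i.-1 j.-1.
Proof.
move=> BE i j; rewrite /one_dsum castmxE /dsum.
set i' := cast_ord _ i; set j' := cast_ord _ j.
have -> : (i : nat) = i' by [].
have -> : (j : nat) = j' by [].
case: (split_ordP i') => u ->; case: (split_ordP j') => v -> /=.
- by rewrite block_mxEul mxE !ord1.
- by rewrite block_mxEur mxE !ord1 /=.
- by rewrite block_mxEdl mxE !ord1 /=.
- by rewrite block_mxEdr BE.
Qed.

Lemma dsum_id_midE (R : pzRingType) (p q : nat) (A : 'M[R]_2)
    (i j : 'I_(p + (2 + q))) :
  dsum (1%:M : 'M[R]_p) (dsum A (1%:M : 'M[R]_q)) i j =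
    if (p <= i < p + 2)%N && (p <= j < p + 2)%N
    then A (inord (i - p)) (inord (j - p)) else (i == j :> nat)%:R.
Proof.
rewrite /dsum.
have in2 (u : 'I_2) : inord (p + (u : nat) - p) = u.
  by apply: val_inj; rewrite /= inordK addKn.
case: (split_ordP i) => u ->; case: (split_ordP j) => v -> /=;
  have := ltn_ord u; have := ltn_ord v => ltv ltu.
- rewrite block_mxEul mxE ifF //; lia.
- rewrite block_mxEur mxE ifF; last lia.
  by case: eqP => //; lia.
- rewrite block_mxEdl mxE ifF; last lia.
  by case: eqP => //; lia.
rewrite block_mxEdr => {ltu ltv}.
case: (split_ordP u) => {}u ->; case: (split_ordP v) => {}v -> /=;
  have := ltn_ord u; have := ltn_ord v => ltv ltu.
- by rewrite block_mxEul ifT ?in2 //; lia.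
- rewrite block_mxEur mxE ifF; last lia.
  by case: eqP => //; lia.
- rewrite block_mxEdl mxE ifF; last lia.
  by case: eqP => //; lia.
- rewrite block_mxEdr mxE ifF; last lia.
  by rewrite !eqn_add2l.
Qed.

(** The leading identity has size [n - k - 1], so in 0-based indices [Rmx k] sits on rows and
    columns [(n - k).-1] and [n - k]. *)
Lemma DtauE (R : realType) (n k : nat) (hk : (2 <= k < n)%N) (i j : 'I_n.-1) :
  Dtau R hk i j =
    if (i == (n - k).-1 :> nat) && (j == (n - k).-1 :> nat) then - (k%:R)^-1
    else if (i == (n - k)%N :> nat) && (j == (n - k)%N :> nat) then (k%:R)^-1
    else if (i == (n - k).-1 :> nat) && (j == (n - k)%N :> nat)
         || (i == (n - k)%N :> nat) && (j == (n - k).-1 :> nat)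
      then Num.sqrt (1 - (k%:R ^+ 2)^-1)
    else (i == j :> nat)%:R.
Proof.
rewrite /Dtau castmxE dsum_id_midE /= mxE.
have [[{}hk kn]] : (2 <= k)%N /\ (k < n)%N by case/andP: hk.
have -> : (n - k - 1 = (n - k).-1)%N by lia.
have e : ((n - k).-1.+1 = n - k)%N by lia.
case: ifP => H; last by do 3 (rewrite ifF; last lia).
have E (m : nat) : ((n - k).-1 <= m < (n - k).-1 + 2)%N ->
   m = (n - k).-1 \/ m = (n - k)%N by lia.
case/andP: H => /E Hi /E Hj.
have s0 : ((n - k).-1 - (n - k).-1 = 0)%N by lia.
have s1 : ((n - k) - (n - k).-1 = 1)%N by lia.
have o : (inord 0 == inord 1 :> 'I_2) = false by rewrite -val_eqE /= !inordK.
have o0 : (inord 0 == 0 :> 'I_2) by rewrite -val_eqE /= !inordK.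
have o1 : (inord 1 == 0 :> 'I_2) = false by rewrite -val_eqE /= !inordK.
have ne : ((n - k).-1 == (n - k)%N) = false by lia.
have ne' : (n - k == (n - k).-1)%N = false by lia.
by case: Hi => ->; case: Hj => ->;
   rewrite ?s0 ?s1 ?eqxx ?ne ?ne' ?o ?o0 ?o1 ?(eq_sym (inord 1)) ?o //=.
Qed.

(** * The identity on adjacent transpositions *)

Lemma TmxE (R : realType) (n : nat) (i j : 'I_n) : Tmx R n i j =
  if i == 0 :> nat then (Num.sqrt n%:R)^-1
  else (Num.sqrt ((n - i) * (n - i).+1)%:R)^-1 *
    (if (j < n - i)%N then -1
     else if j == (n - i)%N :> nat then (n - i)%:R else 0).
Proof. by rewrite /Tmx /Amx mul_diag_mx !mxE; case: ifP; rewrite ?mulr1. Qed.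

Lemma mulmx_tpermE (R : pzRingType) (m n : nat) (A : 'M[R]_(m, n))
    (a b : 'I_n) (i : 'I_m) (j : 'I_n) :
  (A *m perm_mx (tperm a b)) i j = A i (tperm a b j).
Proof. by rewrite -[tperm a b in LHS]invgK -col_permE tpermV mxE. Qed.

(** Only the last row of [Tmx], a multiple of (-1, 1, 0, ..., 0), distinguishes the first two
    columns, and swapping them negates it. *)
Lemma Tmx_tau1 (R : realType) (n : nat) (hn : (2 <= n)%N)
    (h : (1 <= 1 < n)%N) :
  Tmx R n *m perm_mx (tau h) = one_dsum hn (Dtau1 R n)^T *m Tmx R n.
Proof.
apply/matrixP => i j; rewrite mulmx_tpermE [RHS]mxE.
pose f (u v : nat) : R :=
  if u.+1 == n.-1 then (-1) *+ (u == v) else 1 *+ (u == v).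
have DE (u v : 'I_n.-1) : (Dtau1 R n)^T u v = f u v.
  by rewrite /f !mxE -!val_eqE (eq_sym (v : nat));
     case: (eqVneq (u : nat) v) => [->|_]; rewrite ?mulr0n ?if_same.
rewrite (bigD1 i) //= big1 ?addr0 => [|l li]; last first.
  rewrite (one_dsumE hn DE).
  have li' : (i == l :> nat) = false by rewrite eq_sym val_eqE (negbTE li).
  rewrite li'; case: ifP => i0; first by rewrite mul0r.
  have il : (i.-1 == l.-1)%N = false by lia.
  by rewrite /f il !mulr0n; case: ifP; rewrite mul0r.
rewrite (one_dsumE hn DE) /f orbb !eqxx !mulr1n !TmxE /=.
have := ltn_ord i; have := ltn_ord j.
case: ifP => [|i0] jn iN; first by rewrite mul1r.
(* As [i] is nonzero, this test singles out the last row of [Tmx]. *)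
have [i1|i1] := boolP (i.-1.+1 == n.-1).
  have -> : (n - i = 1)%N by lia.
  case: tpermP => [->|->|/eqP + /eqP] /=;
    rewrite ?mulN1r ?mulrN1 ?mulr1 ?opprK //.
  rewrite -!val_eqE /= => j0 j1.
  by rewrite !ifF ?mulr0 ?oppr0 //; lia.
rewrite mul1r; case: tpermP => [->|->|//] /=; rewrite !ifT //; lia.
Qed.

(** The leading 1 shifts the block to rows [n - k] and [(n - k).+1], whose scale factors in [Tmx]
    are 1/sqrt(k(k+1)) and 1/sqrt((k-1)k). In every other row the columns [k.-1] and [k] agree. *)
Lemma Tmx_tau (R : realType) (n : nat) (hn : (2 <= n)%N) (k : nat)
    (h : (1 <= k < n)%N) (hk : (2 <= k < n)%N) :
  Tmx R n *m perm_mx (tau h) = one_dsum hn (Dtau R hk)^T *m Tmx R n.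
Proof.
apply/matrixP => i j; rewrite mulmx_tpermE [RHS]mxE.
set c : R := Num.sqrt (1 - (k%:R ^+ 2)^-1).
pose f (v u : nat) : R :=
    if (u == (n - k).-1) && (v == (n - k).-1) then - (k%:R)^-1
    else if (u == (n - k)%N) && (v == (n - k)%N) then (k%:R)^-1
    else if (u == (n - k).-1) && (v == (n - k)%N)
         || (u == (n - k)%N) && (v == (n - k).-1) then c
    else (u == v)%:R.
have DE (u v : 'I_n.-1) : (Dtau R hk)^T u v = f u v by rewrite mxE DtauE.
have [k2 kn] : (2 <= k)%N /\ (k < n)%N by case/andP: (hk).
have ltan : (n - k < n)%N by lia.
have ltbn : ((n - k).+1 < n)%N by lia.
pose a := Ordinal ltan; pose b := Ordinal ltbn.
have ab : a != b by rewrite -val_eqE /=; lia.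
have := ltn_ord i; have := ltn_ord j => jn iN.
have ck : k%:R != 0 :> R by rewrite pnatr_eq0; lia.
have ck1 : (k.-1)%:R != 0 :> R by rewrite pnatr_eq0; lia.
have kE : k%:R = k.-1%:R + 1 :> R by rewrite natr1 prednK //; lia.
(* These relations turn [c] times the scale factor of one mixed row into a rational multiple of that
   of the other, so a single square root survives in each final identity. *)
have [al be] :
    c * (Num.sqrt (k.-1 * k)%:R)^-1
      = (k%:R + 1) / k%:R * (Num.sqrt (k * k.+1)%:R)^-1 /\
    c * (Num.sqrt (k * k.+1)%:R)^-1
      = k.-1%:R / k%:R * (Num.sqrt (k.-1 * k)%:R)^-1.
  have sq (m : nat) : m%:R = Num.sqrt m%:R ^+ 2 :> R by rewrite sqr_sqrtr.
  have sq0 (m : nat) : (0 < m)%N -> Num.sqrt m%:R != 0 :> R.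
    by move=> m0; rewrite gt_eqF // sqrtr_gt0 ltr0n.
  have cE : c = Num.sqrt k.-1%:R * Num.sqrt k.+1%:R / k%:R.
    (* Writing [k] as the root of its square puts both sides under one root; what remains is 1 -
       1/k^2 = (k-1)(k+1)/k^2. *)
    rewrite -[k%:R in RHS]ger0_norm // -sqrtr_sqr -sqrtrV ?sqr_ge0 //.
    rewrite -!sqrtrM // ?mulr_ge0 //; congr Num.sqrt.
    by rewrite -natr1 kE; field; rewrite -kE.
  have p0 : Num.sqrt k.-1%:R != 0 :> R by apply: sq0; lia.
  have q0 : Num.sqrt k%:R != 0 :> R by apply: sq0; lia.
  have r0 : Num.sqrt k.+1%:R != 0 :> R by apply: sq0.
  rewrite cE natr1 !natrM !sqrtrM //.
  (* With k-1, k, k+1 replaced by p^2, q^2, r^2, both claims become rational identities in p, q,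
     r. *)
  move: p0 q0 r0 (sq k.-1) (sq k) (sq k.+1).
  move: (Num.sqrt k.-1%:R) (Num.sqrt k%:R) (Num.sqrt k.+1%:R) => p q r.
  by move=> p0 q0 r0 -> -> ->; split; field; rewrite ?p0 ?q0 ?r0.
(* Outside rows [a] and [b] the left factor has an identity row, so the sum reduces to the entry of
   [Tmx] at [i], [j]. *)
have [iab|iab] := boolP ((i == a) || (i == b)); last first.
  have {iab} [ia ib] : i <> (n - k)%N :> nat /\ i <> (n - k).+1 :> nat.
    by move: iab; rewrite negb_or -!val_eqE /= => /andP[/eqP ? /eqP ?].
  rewrite (bigD1 i) //= big1 ?addr0 => [|l li]; last first.
    rewrite (one_dsumE hn DE).
    have li' : (i == l :> nat) = false by rewrite eq_sym val_eqE (negbTE li).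
    rewrite li'; case: ifP => i0; first by rewrite mul0r.
    have il : (l.-1 == i.-1)%N = false by lia.
    by rewrite /f il !ifF ?mul0r //; lia.
  rewrite (one_dsumE hn DE) orbb eqxx.
  have -> : (if i == 0%N :> nat then 1%:R else f i.-1 i.-1) = 1.
    by case: ifP => i0 //; rewrite /f eqxx (_ : 1%:R = 1) // !ifF //; lia.
  rewrite mul1r !TmxE; case: ifP => // i0; congr (_ * _).
  by case: tpermP => [->|->|//] /=; do ?case: ifP => //; lia.
(* In rows [a] and [b] only the columns [a] and [b] contribute, leaving a sum of two terms. *)
have Mi l : l != a -> l != b -> one_dsum hn (Dtau R hk)^T i l = 0.
  rewrite (one_dsumE hn DE) -!val_eqE /= => la lb.
  move: iab; rewrite -!val_eqE /= => iab.
  have [i0 il] : (i == 0 :> nat) = false /\ (i == l :> nat) = false by lia.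
  rewrite i0 il /=; case: ifP => // l0.
  have il' : (l.-1 == i.-1)%N = false by lia.
  by rewrite /f il' !ifF //; lia.
rewrite (bigD1 a) // (bigD1 b) 1?eq_sym //= big1 ?addr0 => [|l /andP[la lb]];
  last by rewrite Mi ?mul0r.
rewrite !(one_dsumE hn DE) !TmxE /=.
have -> : (n - k == 0)%N = false by lia.
have -> : (n - (n - k) = k)%N by lia.
have -> : (n - (n - k).+1 = k.-1)%N by lia.
have -> : k.-1.+1 = k by lia.
have i0 : (i == 0 :> nat) = false by move: iab; rewrite -!val_eqE /=; lia.
rewrite i0 /= /f {Mi DE f i0}.
have ne : ((n - k).-1 == n - k)%N = false by lia.
have ne' : (n - k == (n - k).-1)%N = false by lia.
rewrite ne ne' !eqxx /=.
case/orP: iab => /eqP -> /=.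
  rewrite eqxx ne /= (mulrA c) al (_ : n - (n - k) = k)%N; last lia.
  (* The remaining root is a common factor [y]; the cases are j = k-1, j = k, j < k-1 and j > k. *)
  move: (Num.sqrt _)^-1 => y.
  by case: tpermP => [->|->|/eqP + /eqP]; rewrite -?val_eqE /=;
    [ | | move=> *; case: (ltnP j k.-1) => ?];
    repeat first [rewrite ifT; last lia | rewrite ifF; last lia];
    rewrite ?kE; field; rewrite -kE.
rewrite ne' eqxx /= (mulrA c) be (_ : n - (n - k).+1 = k.-1)%N; last lia.
rewrite prednK; last lia.
move: (Num.sqrt _)^-1 => y.
by case: tpermP => [->|->|/eqP + /eqP]; rewrite -?val_eqE /=;
    [ | | move=> *; case: (ltnP j k.-1) => ?];
    repeat first [rewrite ifT; last lia | rewrite ifF; last lia];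
    rewrite ?kE; field; rewrite -kE.
Qed.

(** * From adjacent transpositions to all permutations *)

(** Permutations are products of transpositions, and a transposition is reduced to adjacent ones by
    induction on the distance of its two points. *)
Lemma adjacent_perm_ind (n : nat) (P : 'S_n -> Prop) :
  P 1%g -> (forall s t : 'S_n, P s -> P t -> P (s * t)%g) ->
  (forall k (h : (1 <= k < n)%N), P (tau h)) -> forall s, P s.
Proof.
move=> P1 PM Pt.
have Plt d (i j : 'I_n) : (i + d.+1)%N = j -> P (tperm i j).
  elim: d j => [|d IH] j ij.
    have h : (1 <= j < n)%N by rewrite ltn_ord andbT -ij addn1.
    suff <- : tau h = tperm i j by [].
    by congr tperm; apply: val_inj; rewrite //= -ij addn1.
  have h : (1 <= j < n)%N by rewrite ltn_ord andbT -ij addnS.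
  have IHj := IH (Ordinal (tau_fst h)).
  (* The involution [tau h] swaps j-1 and j, so conjugating (i, j-1) by it gives (i, j). *)
  have -> : tperm i j = (tau h * (tperm i (Ordinal (tau_fst h)) * tau h))%g.
    rewrite -{1}[tau h]invgK tpermV -conjgE tpermJ /tau tpermL.
    rewrite tpermD -?val_eqE /= -?ij ?addnS //=; try lia.
    by congr tperm; apply: val_inj; rewrite /= -ij.
  apply: PM (Pt j h) (PM _ _ (IHj _) (Pt j h)).
  by rewrite /=; lia.
have Pij (i j : 'I_n) : P (tperm i j).
  case: (ltngtP i j) => [ij|ij|/val_inj->]; last by rewrite tperm1.
    by apply: (Plt (j - i).-1); lia.
  by rewrite tpermC; apply: (Plt (i - j).-1); lia.
move=> s; case: (prod_tpermP s) => ts -> _.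
by elim/big_ind: _ => // t _; apply: Pij.
Qed.

Lemma Tmx_perm (R : realType) (n : nat) (hn : (2 <= n)%N)
    (D : 'S_n -> 'M[R]_n.-1) (hD : young_orthogonal D) (s : 'S_n) :
  Tmx R n *m perm_mx s = one_dsum hn (D s)^T *m Tmx R n.
Proof.
case: hD => Dorth DM D1 Dk; elim/adjacent_perm_ind: s => [|s t IHs IHt|k h].
(* [D 1] is idempotent by multiplicativity and invertible by orthogonality, hence the identity. *)
- have : D 1%g *m D 1%g *m (D 1%g)^T = 1%:M by rewrite -DM mulg1 Dorth.
  rewrite -mulmxA Dorth mulmx1 => ->.
  by rewrite perm_mx1 mulmx1 trmx1 one_dsum1 mul1mx.
- by rewrite perm_mxM mulmxA IHs -mulmxA IHt mulmxA one_dsum_mul DM trmx_mul.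
have [k1|k1] := eqVneq k 1%N.
  by move: h; rewrite k1 => h; rewrite D1; apply: Tmx_tau1.
have hk : (2 <= k < n)%N by lia.
by rewrite (Dk k h hk); apply: Tmx_tau.
Qed.

Theorem theorem3p2 (R : realType) (n : nat) (hn : (2 <= n)%N)
    (D : 'S_n -> 'M[R]_n.-1) (hD : young_orthogonal D)
    (s : 'S_n) (x : 'cV[R[i]]_n) :
  let X := toC (Tmx R n) *m x in
  toC (Tmx R n) *m perm_mx s *m x = toC (one_dsum hn (D s)^T) *m X.
Proof.
(* Once [x] is removed, both sides are images of real matrices under the embedding of the reals in
   the complex numbers, so the real identity suffices. *)
rewrite /= mulmxA; congr (_ *m _).
by rewrite /toC -(map_perm_mx (real_complex R)) -!map_mxM (Tmx_perm hn hD).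
Qed.
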